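(* Let $G$ be a finite connected undirected graph and let $i$ be a node of $G$. Let $(X_n)_{n\ge 0}$ start at $X_0=i$. Let $V_0=0$ and $V_k=\inf\{n>V_{k-1}: X_n=i\}$ for $k\ge1$ (with $V_k=\infty$ if $V_{k-1}=\infty$), let $T_j=\inf\{n\ge1: X_n=j\}$, and let $N_j=\inf\{k\ge1: T_j\le V_k\}$ (the index of the excursion from $i$ during which $j$ is first visited). Then for every node $j\neq i$, $$\mathbb E_{\pi_{loc}}[N_j\mid X_0=i]\le \mathbb E_{\pi_{rw}}[N_j\mid X_0=i],$$ where $\pi_{loc}$ is the local negative feedback algorithm at $i$ and $\pi_{rw}$ is the random walk.
   Context: Random walk $\pi_{rw}$: if $X_n=v$, then $X_{n+1}$ is a uniformly random neighbour of $v$ (probability $1/d_v$ each, $d_v$ the degree of $v$), independently of the past. For nodes $v,w$ with $\{v,w\}$ an edge, let $N_{vw}^{(n)}$ be the number of times $m<n$ with $X_m=v,X_{m+1}=w$. Let $Nmin_v^{(n)}=\min_{w:\{v,w\}\text{ edge}}N_{vw}^{(n)}$, $Smin_v^{(n)}=\{w:\{v,w\}\text{ edge}, N_{vw}^{(n)}=Nmin_v^{(n)}\}$ and $Kmin_v^{(n)}=|Smin_v^{(n)}|$. Local negative feedback algorithm $\pi_{loc}$ (at the start node $i$): whenever $X_n=i$, $X_{n+1}$ is chosen uniformly at random from $Smin_i^{(n)}$ (probability $1/Kmin_i^{(n)}$ each); whenever $X_n=v\neq i$, $X_{n+1}$ is chosen by the random walk rule, uniformly among the neighbours of $v$. *)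

(* Defs.v *)
(* MathComp / MathComp-Analysis *)
From HB Require Import structures.
From mathcomp Require Export all_boot all_order all_algebra.
From mathcomp Require Export all_classical all_reals all_analysis.
Set Implicit Arguments.
Unset Strict Implicit.
Unset Printing Implicit Defensive.
Import Order.TTheory GRing.Theory Num.Theory.
Local Open Scope classical_set_scope.
Local Open Scope ring_scope.

(* A finite graph is given by its adjacency relation on a finite type of nodes.
   Loops are not excluded; a simple graph is the irreflexive case. *)
Definition connected_graph (T : finType) (e : rel T) : Prop :=
  symmetric e /\ forall v w : T, connect e v w.

(* A rule gives the conditional probability of moving to w at time n.+1 given
   the trajectory up to time n; the rules below read only x 0, ..., x n. *)
Definition rule (R : realType) (T : finType) := (nat -> T) -> nat -> T -> R.

Section Rules.
Variables (R : realType) (T : finType) (e : rel T).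
Implicit Types (x : nat -> T) (n : nat) (v w i : T).

Definition degree v : nat := #|[pred w | e v w]|.

Definition crossings x n v w : nat :=
  \sum_(m < n) ((x m == v) && (x m.+1 == w)).

(* The default value n of the iterated minimum is harmless: crossings x n v w
   is at most n, so this is the minimum as soon as v has a neighbour. *)
Definition Nmin x n v : nat := \big[minn/n]_(w | e v w) crossings x n v w.

Definition Smin x n v : {set T} :=
  [set w | e v w && (crossings x n v w == Nmin x n v)].

Definition Kmin x n v : nat := #|Smin x n v|.

Definition random_walk : rule R T := fun x n w =>
  if e (x n) w then (degree (x n))%:R^-1 else 0.

Definition local_feedback i : rule R T := fun x n w =>
  if x n == i then (if w \in Smin x n i then (Kmin x n i)%:R^-1 else 0)
  else random_walk x n w.

End Rules.

Arguments random_walk : clear implicits.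
Arguments random_walk R {T} e _ _ _.
Arguments local_feedback : clear implicits.
Arguments local_feedback R {T} e i _ _ _.

Definition history (Omega : Type) (T : finType) (X : nat -> Omega -> T)
    (x : nat -> T) (n : nat) : set Omega :=
  [set omega | forall m, (m <= n)%N -> X m omega = x m].

(* X is a T-valued process (T discrete) started at i whose law under P is
   determined by the rule p; the transition identity is written as a product
   so that histories of probability zero need no separate treatment. *)
Record follows (R : realType) (T : finType) (d : measure_display)
    (Omega : measurableType d) (P : probability Omega R)
    (X : nat -> Omega -> T) (p : rule R T) (i : T) : Prop := Follows {
  follows_measurable : forall n (A : set T), measurable (X n @^-1` A);
  follows_start : P (X 0%N @^-1` [set i]) = 1%E;
  follows_step : forall (n : nat) (x : nat -> T) (w : T),
    P (history X x n `&` X n.+1 @^-1` [set w])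
      = (P (history X x n) * (p x n w)%:E)%E
}.

(* Times are extended reals, with ereal_inf set0 = +oo.  In particular
   return_time x i k.+1 = +oo when return_time x i k = +oo. *)
Section Times.
Variables (R : realType) (T : finType) (x : nat -> T).
Implicit Types i j : T.

Fixpoint return_time i (k : nat) : \bar R :=
  if k is k'.+1 then
    ereal_inf [set n%:R%:E | n in
      [set n : nat | (return_time i k' < n%:R%:E)%E /\ x n = i]]
  else 0%E.

Definition hitting_time j : \bar R :=
  ereal_inf [set n%:R%:E | n in [set n : nat | (1 <= n)%N /\ x n = j]].

Definition hitting_excursion i j : \bar R :=
  ereal_inf [set k%:R%:E | k in
    [set k : nat | (1 <= k)%N /\ (hitting_time j <= return_time i k)%E]].

End Times.

Arguments return_time : clear implicits.
Arguments return_time R {T} x i k.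
Arguments hitting_time : clear implicits.
Arguments hitting_time R {T} x j.
Arguments hitting_excursion : clear implicits.
Arguments hitting_excursion R {T} x i j.

(* An extended-real integral, since the index may be infinite. *)
Definition mean_hitting_excursion (R : realType) (T : finType)
    (d : measure_display) (Omega : measurableType d) (P : probability Omega R)
    (X : nat -> Omega -> T) (i j : T) : \bar R :=
  (\int[P]_omega hitting_excursion R (fun n => X n omega) i j)%E.

(* Main.v *)
(** Let a w be the probability that the walk from w comes back to i before j,
and abar the mean of a over the d neighbours of i. The walk avoids j during r
excursions with probability abar ^ r. Under the feedback rule the exits from i
run through random permutations of the neighbours, so the same probability is a
product of normalised elementary symmetric functions of the a w, and each of
them is at most the corresponding power of abar by Maclaurin's inequality.
Summing over r compares the means of N_j.

Recurrence of the walk is never needed: everything is done with the probability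
a_t w of coming back within t steps. A run of n steps under the feedback rule
survives r excursions with probability at most abar_n ^ r, while the walk does
so within r * n.+1 steps with probability at least abar_n ^ r, by giving
n.+1 steps to each excursion. *)

Require Import Defs.
From mathcomp Require Import measurable_realfun zify ring.
Set Implicit Arguments.
Unset Strict Implicit.
Unset Printing Implicit Defensive.
Import Order.TTheory GRing.Theory Num.Theory.
Local Open Scope classical_set_scope.
Local Open Scope ring_scope.

(** * Maclaurin's inequality for products over unused exits *)

Section SubsetMeans.
Variables (R : realFieldType) (T : finType) (a : T -> R).
Implicit Types (S D : {set T}) (r n : nat) (mu b : R).

(** Convexity of [mu ^+ r.+1] against its tangent at [b], in polynomial form: each induction step
    multiplies by [mu] and adds a nonnegative multiple of [(mu - b) ^+ 2]. *)
Lemma weighted_AGM r mu b : 0 <= mu -> 0 <= b ->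
  0 <= mu ^+ r.+1 - r.+1%:R * mu * b ^+ r + r%:R * b ^+ r.+1.
Proof.
move=> mu0 b0; elim: r => [|r IH]; first by rewrite expr1 expr0 mul1r mulr1 subrr add0r
  mul0r.
have -> : mu ^+ r.+2 - r.+2%:R * mu * b ^+ r.+1 + r.+1%:R * b ^+ r.+2
  = mu * (mu ^+ r.+1 - r.+1%:R * mu * b ^+ r + r%:R * b ^+ r.+1)
    + r.+1%:R * b ^+ r * (mu - b) ^+ 2.
  rewrite [mu ^+ r.+2]exprS [b ^+ r.+2]exprS [b ^+ r.+1]exprS -!natr1; ring.
apply: addr_ge0; first exact: mulr_ge0.
by rewrite mulr_ge0 ?sqr_ge0 ?mulr_ge0 ?exprn_ge0.
Qed.

(** Meant for [n] the size of a set, [mu] its mean and [b] its mean without [w]: then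
    [n%:R * mu - n.-1%:R * b] is [a w]. The right side is the tangent in [b] at [mu], whose linear
    term cancels in the sum over [w]. The gap is [weighted_AGM] plus a product of two factors of
    equal sign. *)
Lemma tangent_line r n mu b : (r < n)%N -> 0 <= mu -> 0 <= b ->
  (n%:R * mu - n.-1%:R * b) * b ^+ r
    <= mu ^+ r.+1 + (n%:R - r.+1%:R) * mu ^+ r * (mu - b).
Proof.
move=> rn mu0 b0; set c := (n - r.+1)%N.
have -> : n%:R = r.+1%:R + c%:R :> R by rewrite -natrD subnKC.
have -> : n.-1%:R = r%:R + c%:R :> R by rewrite -natrD; congr (_%:R); lia.
have Hw := weighted_AGM r mu0 b0.
have Hm : 0 <= c%:R * ((mu - b) * (mu ^+ r - b ^+ r)).
  rewrite mulr_ge0 //; case: (leP b mu) => h.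
    by rewrite mulr_ge0 ?subr_ge0 ?lerXn2r // nnegrE.
  by rewrite mulr_le0 ?subr_le0 ?lerXn2r ?nnegrE // ltW.
rewrite -subr_ge0; apply: le_trans (addr_ge0 Hw Hm) _.
by rewrite le_eqVlt; apply/orP; left; apply/eqP; rewrite !exprS -!natr1; ring.
Qed.

Definition set_mean S : R := #|S|%:R^-1 * \sum_(w in S) a w.

(* The survival probability of r further excursions, when S is the set of the
   exits still unused in the current block and D the set of all exits: it
   bounds the average of the products of a over the r-subsets of S
   (Maclaurin), and beyond the current block it charges set_mean D each. *)
Definition survival_bound D r S : R :=
  if (r <= #|S|)%N then set_mean S ^+ r
  else \prod_(w in S) a w * set_mean D ^+ (r - #|S|).

Hypothesis a0 : forall w, 0 <= a w.

Lemma set_mean_ge0 S : 0 <= set_mean S.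
Proof. by rewrite mulr_ge0 ?invr_ge0 ?sumr_ge0. Qed.

Lemma survival_bound_ge0 D r S : 0 <= survival_bound D r S.
Proof.
rewrite /survival_bound; case: ifP => _; first by rewrite exprn_ge0 ?set_mean_ge0.
by rewrite mulr_ge0 ?prodr_ge0 ?exprn_ge0 ?set_mean_ge0.
Qed.

Lemma survival_bound_0 D S : survival_bound D 0 S = 1.
Proof. by []. Qed.

Lemma survival_bound_set0 D r : survival_bound D r finset.set0 = set_mean D ^+ r.
Proof.
rewrite /survival_bound cards0 leqn0 subn0 big_set0 mul1r.
by case: r.
Qed.

(** Beyond [#|D|] exits all of [D] is used up, and AM-GM bounds its product by a power of the
    mean. *)
Lemma survival_bound_full D r : survival_bound D r D <= set_mean D ^+ r.
Proof.
rewrite /survival_bound; case: leqP => // Dr.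
rewrite -{2}(subnKC (ltnW Dr)) exprD ler_wpM2r ?exprn_ge0 ?set_mean_ge0 //.
rewrite /set_mean mulrC.
have [le_AGM _] := @leif_AGM R T (mem D) a (fun w _ => a0 w).
exact: le_AGM.
Qed.

(** Expanding over the first exit is the induction behind Maclaurin's inequality: [tangent_line] is
    summed over [w]. Once [r] reaches [#|S|], all summands are the same product and equality
    holds. *)
Lemma survival_bound_step D r S : (0 < #|S|)%N ->
  #|S|%:R^-1 * \sum_(w in S) a w * survival_bound D r (S :\ w)
    <= survival_bound D r.+1 S.
Proof.
move=> S0; have cardD w : w \in S -> #|S :\ w| = #|S|.-1.
  by move=> wS; rewrite (cardsD1 w S) wS.
have nz : #|S|%:R != 0 :> R by rewrite pnatr_eq0 -lt0n.
rewrite /survival_bound; case: (ltnP r #|S|) => rS.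
  case: r rS => [|r] rS.
    by rewrite expr1 (eq_bigr a) // => w _; rewrite leq0n expr0 mulr1.
  set mu := set_mean S.
  pose b w := set_mean (S :\ w).
  have m0 : #|S|.-1%:R != 0 :> R by rewrite pnatr_eq0; lia.
  have sumS : \sum_(w in S) a w = #|S|%:R * mu by rewrite /mu /set_mean mulVKf.
  have bE w : w \in S -> #|S|.-1%:R * b w = #|S|%:R * mu - a w.
    move=> wS; rewrite /b /set_mean cardD // mulVKf //.
    by rewrite -sumS (big_setD1 w wS) addrC addKr.
  (* The means over [S :\ w] average to the mean over [S]; clearing their common denominator shows
     it. *)
  have sumb : \sum_(w in S) (mu - b w) = 0.
    apply: (mulfI m0); rewrite mulr0 big_distrr /=.
    rewrite (eq_bigr (fun w => a w - mu)) => [|w wS].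
      by rewrite big_split /= sumr_const sumS mulNrn -[mu *+ _]mulr_natl subrr.
    rewrite mulrBr bE // -[in #|S|%:R](prednK S0) -natr1; ring.
  rewrite ler_pdivrMl ?ltr0n //.
  apply: (@le_trans _ _ (\sum_(w in S)
     (mu ^+ r.+2 + (#|S|%:R - r.+2%:R) * mu ^+ r.+1 * (mu - b w)))).
    apply: ler_sum => w wS; rewrite cardD // ifT; last by lia.
    have -> : a w = #|S|%:R * mu - #|S|.-1%:R * b w by rewrite bE //; ring.
    by apply: tangent_line => //; exact: set_mean_ge0.
  by rewrite big_split /= sumr_const -big_distrr /= sumb mulr0 addr0 mulr_natl.
rewrite [in X in X <= _](eq_bigr (fun=>
  \prod_(w in S) a w * set_mean D ^+ (r.+1 - #|S|))).
  by rewrite /= sumr_const -[X in _ * X]mulr_natl mulKf.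
move=> w wS; rewrite cardD // ifF; last by lia.
by rewrite (big_setD1 w wS) /= mulrA; congr (_ * _ ^+ _); lia.
Qed.

(** Refilling an exhausted block is harmless: the empty set is charged [set_mean D ^+ r], which
    dominates the value at the full set. *)
Lemma survival_bound_exit D r S (S' : T -> {set T}) : (0 < #|S|)%N ->
  (forall w, w \in S -> S' w = if S :\ w == finset.set0 then D else S :\ w) ->
  #|S|%:R^-1 * \sum_(w in S) a w * survival_bound D r (S' w)
    <= survival_bound D r.+1 S.
Proof.
move=> S0 S'E; apply: le_trans (survival_bound_step D r S0).
rewrite ler_wpM2l ?invr_ge0 // ler_sum // => w wS; rewrite ler_wpM2l // S'E //.
by case: eqP => [->|_] //; rewrite survival_bound_set0 survival_bound_full.
Qed.

End SubsetMeans.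

(** * Visits and crossings along a trajectory *)

Section Trajectories.
Variables (T : finType) (e : rel T) (i j : T).
Implicit Types (x : nat -> T) (n : nat) (v w u : T).

Definition extend x n w : nat -> T := fun m => if (m <= n)%N then x m else w.

Lemma extend_le x n w m : (m <= n)%N -> extend x n w m = x m.
Proof. by rewrite /extend => ->. Qed.

Lemma extend_last x n w : extend x n w n.+1 = w.
Proof. by rewrite /extend ltnn. Qed.

(* Time 0 is not tested, as in hitting_time. *)
Fixpoint alive x n : bool :=
  if n is n'.+1 then alive x n' && (x n != j) else true.

Definition visits x n : nat := \sum_(m < n) ((x m.+1 == i) && alive x m.+1).

Lemma visitsS x n :
  visits x n.+1 = (visits x n + ((x n.+1 == i) && alive x n.+1))%N.
Proof. by rewrite /visits big_ord_recr. Qed.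

Lemma alive_ext x y n : (forall m, (m <= n)%N -> x m = y m) ->
  alive x n = alive y n.
Proof.
elim: n => //= n IH xy; rewrite xy // IH // => m mn.
by apply: xy; exact: leqW.
Qed.

Lemma visits_ext x y n : (forall m, (m <= n)%N -> x m = y m) ->
  visits x n = visits y n.
Proof.
move=> xy; apply: eq_bigr => m _; rewrite xy ?ltn_ord //.
rewrite (@alive_ext x y) // => k km; apply: xy; exact: leq_trans km (ltn_ord m).
Qed.

Lemma visits_mono x : {homo visits x : m n / (m <= n)%N}.
Proof.
by apply: homo_leq => [//|n m k|n]; [exact: leq_trans|rewrite visitsS leq_addr].
Qed.

Lemma alive_antimono x m n : (m <= n)%N -> alive x n -> alive x m.
Proof.
move/subnKC <-; elim: (n - m)%N => [|k IH]; rewrite ?addn0 // addnS.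
by move=> /andP[/IH].
Qed.

Lemma visits_dead x n t : ~~ alive x n -> visits x (n + t) = visits x n.
Proof.
move=> dead; elim: t => [|t IH]; rewrite ?addn0 // addnS visitsS IH.
case: (boolP (alive x (n + t).+1)) => [|_]; last by rewrite andbF addn0.
by move/(alive_antimono (leqW (leq_addr t n))); rewrite (negbTE dead).
Qed.

Lemma alive_extend x n w : alive (extend x n w) n.+1 = alive x n && (w != j).
Proof.
by rewrite /= extend_last (@alive_ext _ x) // => m mn; rewrite extend_le.
Qed.

Lemma visits_extend x n w : visits (extend x n w) n.+1 =
  (visits x n + ((w == i) && (alive x n && (w != j))))%N.
Proof.
rewrite visitsS extend_last alive_extend (@visits_ext _ x) // => m mn.
by rewrite extend_le.
Qed.

Lemma crossings_extend x n w v u : crossings (extend x n w) n.+1 v u =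
  (crossings x n v u + ((x n == v) && (w == u)))%N.
Proof.
rewrite /crossings big_ord_recr /= extend_last extend_le //; congr addn.
by apply: eq_bigr => m _; rewrite !extend_le // ltnW.
Qed.

(** Pairwise comparison frees minimality from the default value of [Nmin]. *)
Lemma SminP x n v : Smin e x n v = [set u | e v u &&
  [forall w, e v w ==> (crossings x n v u <= crossings x n v w)%N]]%SET.
Proof.
apply/setP => u; rewrite !inE; case: (boolP (e v u)) => //= vu.
have Nmin_le w : e v w -> (Nmin e x n v <= crossings x n v w)%N.
  move=> vw; rewrite /Nmin; elim: (index_enum T) (mem_index_enum w) => // u' s IH.
  rewrite in_cons big_cons => /orP[/eqP <-|/IH ws]; first by rewrite vw geq_minl.
  by case: ifP => // _; rewrite geq_min ws orbT.
apply/eqP/forall_inP => [-> //|umin]; apply/eqP; rewrite eqn_leq Nmin_le // andbT.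
rewrite /Nmin; elim/big_ind: _ => //; first last.
- by move=> a b; rewrite leq_min => -> ->.
(* The default [n] bounds every count, since each step makes at most one crossing. *)
rewrite /crossings -[leqRHS]card_ord -sum1_card.
by apply: leq_sum => m _; exact: leq_b1.
Qed.

(* Holds almost surely under the feedback rule; without it, exhausting Smin
   would not make all the neighbours of i minimal again. *)
Definition balanced x n := forall u w, e i u -> e i w ->
  (crossings x n i u <= (crossings x n i w).+1)%N.

Lemma crossings0 x v u : crossings x 0 v u = 0%N.
Proof. by rewrite /crossings big_ord0. Qed.

Lemma balanced0 x : balanced x 0.
Proof. by move=> u w _ _; rewrite !crossings0. Qed.

Lemma Smin0 x v : Smin e x 0 v = [set u | e v u]%SET.
Proof.
rewrite SminP; apply/setP => u; rewrite !inE; case: (e v u) => //=.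
by apply/forall_inP => w _; rewrite !crossings0.
Qed.

(** Only a least used exit gains a crossing, so it ends at most one above any other. *)
Lemma balanced_extend x n w : (x n == i -> w \in Smin e x n i) ->
  balanced x n -> balanced (extend x n w) n.+1.
Proof.
move=> wS bal u v iu iv; rewrite !crossings_extend.
case: (x n == i) wS => [/(_ isT)|_]; last by rewrite !addn0; exact: bal.
rewrite SminP inE => /andP[iw /forall_inP wmin] /=.
have [<-|_] := eqVneq w u; last by have := bal _ _ iu iv; lia.
have := wmin _ iv; lia.
Qed.

Lemma Smin_extend_away x n w : x n != i ->
  Smin e (extend x n w) n.+1 i = Smin e x n i.
Proof.
move=> xni; rewrite !SminP; apply/setP => u; rewrite !inE; congr andb.
by apply: eq_forallb => v; rewrite !crossings_extend (negbTE xni) !addn0.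
Qed.

(** While other least used exits remain, the minimum is unchanged and [w] drops out. If [w] was the
    last one, balance puts every other exit exactly one above it, so its crossing levels all counts
    and a new block begins. *)
Lemma Smin_extend_exit x n w : x n = i -> balanced x n -> w \in Smin e x n i ->
  Smin e (extend x n w) n.+1 i =
    if (Smin e x n i :\ w)%SET == finset.set0 then [set u | e i u]%SET
    else (Smin e x n i :\ w)%SET.
Proof.
move=> xni bal wS; have := wS; rewrite {1}SminP inE => /andP[iw /forall_inP wmin].
have cE u : crossings (extend x n w) n.+1 i u = (crossings x n i u + (w == u))%N.
  by rewrite crossings_extend xni eqxx.
have [S1|/set0Pn[v]] := eqVneq.
  rewrite SminP; apply/setP => u; rewrite !inE; case: (boolP (e i u)) => //= iu.
  have all1 v : e i v -> crossings (extend x n w) n.+1 i v = (crossings x n i w).+1.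
    move=> iv; rewrite cE; have [->|wv] := eqVneq; first by rewrite addn1.
    have : v \notin (Smin e x n i :\ w)%SET by rewrite S1 inE.
    rewrite in_setD1 eq_sym wv /= SminP inE iv /= => /forall_inPn[u' iu'].
    by rewrite -ltnNge; have := bal _ _ iv iw; have := wmin _ iu'; lia.
  by apply/forall_inP => v iv; rewrite !all1.
rewrite in_setD1 => /andP[vw]; rewrite {1}SminP inE => /andP[iv /forall_inP vmin].
apply/setP => u; rewrite in_setD1 !SminP !inE.
case: (boolP (e i u)) => iu /=; last by rewrite andbF.
apply/forall_inP/andP => [umin|[uw /forall_inP umin] u' iu'].
  have := umin _ iv; rewrite !cE (eq_sym w v) (negbTE vw) addn0 => uv.
  have := vmin _ iw; have := vmin _ iu; have := wmin _ iu.
  have [wu|wu] := eqVneq w u => /=.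
    by move: uv; rewrite wu eqxx; lia.
  move=> h1 h2 h3; split=> //.
  by apply/forall_inP => u' iu'; have := wmin _ iu'; move: uv; rewrite (negbTE wu); lia.
rewrite !cE (eq_sym w u) (negbTE uw) addn0; have := umin _ iu'; lia.
Qed.

End Trajectories.

(** * Probabilities of histories *)

Section Process.
Variables (R : realType) (T : finType) (d : measure_display).
Variables (Omega : measurableType d) (P : probability Omega R).
Variables (X : nat -> Omega -> T) (p : rule R T) (i : T).
Hypothesis law : follows P X p i.
Implicit Types (x : nat -> T) (n : nat) (w : T) (A : set Omega).

Local Notation path omega := (fun n => X n omega).

Lemma measurable_event n (Q : pred T) : measurable [set omega | Q (X n omega)].
Proof. exact: (follows_measurable law n [set v | Q v]). Qed.

Lemma history_extend x n w :
  history X (extend x n w) n.+1 = history X x n `&` X n.+1 @^-1` [set w].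
Proof.
apply/seteqP; split => [omega h|omega [h hw] m]; last first.
  rewrite leq_eqVlt => /predU1P[->|]; first by rewrite extend_last.
  by rewrite ltnS => mn; rewrite extend_le // h.
split; last by have := h _ (leqnn _); rewrite extend_last.
by move=> m mn; rewrite h ?extend_le // leqW.
Qed.

Lemma measurable_history x n : measurable (history X x n).
Proof.
elim: n => [|n IH].
  rewrite (_ : history _ _ _ = X 0%N @^-1` [set x 0%N]).
    exact: follows_measurable law _ _.
  apply/seteqP; split => [omega h|omega h m]; first exact: h.
  by rewrite leqn0 => /eqP ->.
rewrite (_ : history _ _ _ = history X x n `&` X n.+1 @^-1` [set x n.+1]).
  by apply: measurableI => //; exact: follows_measurable law _ _.
apply/seteqP; split => [omega h|omega [h hw] m].
  by split; [move=> m mn; apply: h; exact: leqW|exact: h].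
by rewrite leq_eqVlt => /predU1P[->|]; [exact: hw|rewrite ltnS; exact: h].
Qed.

Definition prob A : R := fine (P A).

Lemma EFin_prob A : measurable A -> (prob A)%:E = P A.
Proof. by move=> mA; rewrite /prob fineK ?fin_num_measure. Qed.

Lemma prob_ge0 A : 0 <= prob A.
Proof. exact/fine_ge0/measure_ge0. Qed.

Lemma le_prob A B : measurable A -> measurable B -> A `<=` B ->
  prob A <= prob B.
Proof.
move=> mA mB AB; rewrite fine_le ?fin_num_measure //.
by apply: le_measure => //; rewrite inE.
Qed.

Lemma prob_extend x n w :
  prob (history X (extend x n w) n.+1) = prob (history X x n) * p x n w.
Proof.
rewrite history_extend /prob (follows_step law) fineM //.
by rewrite fin_num_measure //; exact: measurable_history.
Qed.

Lemma prob_step x n A : measurable A -> prob (history X x n `&` A) =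
  \sum_w prob (history X (extend x n w) n.+1 `&` A).
Proof.
move=> mA; have mH := measurable_history.
rewrite /prob sum_fine => [|w _]; last first.
  by rewrite fin_num_measure //; exact: measurableI.
congr fine.
have -> : history X x n `&` A =
    \bigcup_(w in [set` index_enum T]) (history X (extend x n w) n.+1 `&` A).
  apply/seteqP; split => [omega [h oA]|omega [w _ [h oA]]].
    exists (X n.+1 omega); first by rewrite /= mem_index_enum.
    by rewrite history_extend.
  by rewrite history_extend in h; case: h.
rewrite measure_fin_bigcup //; first last.
- by move=> w _; exact: measurableI.
- move=> v w _ _ [omega [[]]]; rewrite !history_extend.
  by move=> [_ /= <-] _ [[_ /= <-] _].
by apply/esym; apply: fsbig_seq; exact: index_enum_uniq.
Qed.

Lemma prob_start A : measurable A ->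
  prob A = prob (history X (fun=> i) 0 `&` A).
Proof.
move=> mA; have -> : history X (fun=> i) 0 = X 0%N @^-1` [set i].
  apply/seteqP; split => [omega h|omega h m]; first exact: h.
  by rewrite leqn0 => /eqP ->.
have mS : measurable (X 0%N @^-1` [set i]) by exact: follows_measurable law _ _.
rewrite /prob setIC [in LHS](measureDI P mA mS).
(* The part of [A] off the start event lies in a null set. *)
rewrite (@subset_measure0 _ _ _ P (A `\` _) (~` (X 0%N @^-1` [set i]))) ?add0e //.
- exact: measurableD.
- exact: measurableC.
by have := probability_setC P mS; rewrite (follows_start law) subee.
Qed.

Lemma prob_start1 : prob (history X (fun=> i) 0) = 1.
Proof.
have mH := measurable_history (fun=> i) 0.
by rewrite -[history _ _ _]setIT -prob_start // /prob probability_setT.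
Qed.

Variable j : T.

(* The union over n of survives r n is the event N_j > r. *)
Definition survives r n : set Omega :=
  [set omega | (r <= visits i j (path omega) n)%N].

Lemma measurable_alive n : measurable [set omega | alive j (path omega) n].
Proof.
elim: n => [|n IH] /=; first by rewrite (_ : [set _ | _] = setT) //; apply/seteqP.
rewrite (_ : [set _ | _] = [set omega | alive j (path omega) n] `&`
  [set omega | X n.+1 omega != j]).
  by apply: measurableI => //; exact: measurable_event n.+1 (fun v => v != j).
by apply/seteqP; split => omega /andP.
Qed.

Lemma measurable_survives r n : measurable (survives r n).
Proof.
elim: n r => [|n IH] r.
  rewrite /survives /visits; under eq_set do rewrite big_ord0.
  case: (r <= 0)%N; first by rewrite (_ : [set _ | _] = setT) //; apply/seteqP.
  by rewrite (_ : [set _ | _] = set0) //; apply/seteqP; split.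
(* The [r]-th entry is already made or happens at time [n.+1]; for [r = 0] the first set is
   everything. *)
rewrite (_ : survives r n.+1 = survives r n `|` (survives r.-1 n `&`
  ([set omega | X n.+1 omega == i] `&` [set omega | alive j (path omega) n.+1]))).
  apply: measurableU => //; apply: measurableI => //; apply: measurableI.
    exact: measurable_event n.+1 (fun v => v == i).
  exact: measurable_alive.
apply/seteqP; split => omega; rewrite /survives /= visitsS.
  case: (boolP (_ && _)) => [/andP[ni al]|_]; last by rewrite addn0; left.
  by rewrite addn1 => h; right; split => //; lia.
case=> [h|[h [ni al]]]; first exact: leq_trans (leq_addr _ _).
have -> : (X n.+1 omega == i) && alive j (path omega) n.+1 by apply/andP.
by move: h; rewrite /survives /= addn1; lia.
Qed.

(** Base case of the inductions on the remaining time: the history up to [n] decides the event. *)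
Lemma prob_survives x n r :
  prob (history X x n `&` survives r n) =
    if (r <= visits i j x n)%N then prob (history X x n) else 0.
Proof.
have E omega : history X x n omega -> visits i j (path omega) n = visits i j x n.
  by move=> h; exact: visits_ext.
case: ifPn => h.
  congr prob; apply/seteqP; split => [omega []//|omega ho]; split => //.
  by rewrite /survives /= E.
rewrite (_ : _ `&` _ = set0) ?/prob ?measure0 //.
by apply/seteqP; split => // omega [ho]; rewrite /survives /= E // (negbTE h).
Qed.

End Process.

(** * Survival under the two rules *)

Section WalkSurvival.
Variables (R : realType) (T : finType) (e : rel T) (i j : T).
Implicit Types (r s t : nat) (v w : T).

(* The probability that the random walk started at v enters i r times
   within t steps without meeting j. *)
Fixpoint walk_survival t r v : R :=
  if r is r'.+1 then
    if t is t'.+1 then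
      (degree e v)%:R^-1 * \sum_(w | e v w)
        (if w == j then 0
         else if w == i then walk_survival t' r' w else walk_survival t' r w)
    else 0
  else 1.

Lemma walk_survival0 t v : walk_survival t 0 v = 1.
Proof. by case: t. Qed.

Lemma walk_survivalS t r v : walk_survival t.+1 r.+1 v =
  (degree e v)%:R^-1 * \sum_(w | e v w)
    (if w == j then 0
     else if w == i then walk_survival t r w else walk_survival t r.+1 w).
Proof. by []. Qed.

Lemma walk_survival_ge0 t r v : 0 <= walk_survival t r v.
Proof.
elim: t r v => [|t IH] [|r] v //=.
rewrite mulr_ge0 ?invr_ge0 // sumr_ge0 // => w _.
by case: ifP => // _; case: ifP.
Qed.

Lemma walk_survival_mono r v s t : (s <= t)%N ->
  walk_survival s r v <= walk_survival t r v.
Proof.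
move: s t; apply: (@homo_leq _ (fun t => walk_survival t r v) (fun a b => a <= b)).
- by [].
- by move=> y x z; exact: le_trans.
move=> t.
elim: t r v => [|t IH] [|r] v; rewrite ?walk_survival0 //.
  exact: walk_survival_ge0.
rewrite !walk_survivalS ler_wpM2l ?invr_ge0 // ler_sum // => w _.
by case: ifP => // _; case: ifP.
Qed.

(** Markov property at the first entry to [i]: [t] steps are reserved for it and [s] for the rest;
    steps left over are absorbed by monotonicity. *)
Lemma walk_survival_superM t s r v :
  walk_survival t 1 v * walk_survival s r i <= walk_survival (t + s) r.+1 v.
Proof.
elim: t v => [|t IH] v; first by rewrite mul0r walk_survival_ge0.
rewrite addSn !walk_survivalS -mulrA ler_wpM2l ?invr_ge0 // big_distrl /=.
apply: ler_sum => w _; case: ifP => _; first by rewrite mul0r.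
case: eqP => [->|_]; last exact: IH.
by rewrite walk_survival0 mul1r walk_survival_mono ?leq_addl.
Qed.

Lemma walk_survival_expr t r :
  walk_survival t 1 i ^+ r <= walk_survival (r * t) r i.
Proof.
elim: r => [|r IH]; first by rewrite walk_survival0.
rewrite exprS mulSn; apply: le_trans (walk_survival_superM _ _ _ _).
by rewrite ler_wpM2l ?walk_survival_ge0.
Qed.

(** The [a_t] of the overview. Unlike in [walk_survival t 1], the present state counts: [i] is a
    return already, [j] a failure. *)
Definition walk_return t v : R :=
  if v == j then 0 else if v == i then 1 else walk_survival t 1 v.

Lemma walk_survival1 t v : walk_survival t.+1 1 v =
  (degree e v)%:R^-1 * \sum_(w | e v w) walk_return t w.
Proof.
rewrite walk_survivalS; congr (_ * _); apply: eq_bigr => w _.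
by rewrite walk_survival0.
Qed.

Lemma walk_return_ge0 t v : 0 <= walk_return t v.
Proof.
by rewrite /walk_return; case: ifP => // _; case: ifP => // _; exact: walk_survival_ge0.
Qed.

Lemma walk_return_mono v s t : (s <= t)%N -> walk_return s v <= walk_return t v.
Proof.
move=> st; rewrite /walk_return; case: ifP => // _; case: ifP => // _.
exact: walk_survival_mono.
Qed.

(** This is [abar_t]: one step leaves [i], and [t] steps remain to come back. *)
Lemma set_mean_exits t :
  set_mean (walk_return t) [set u | e i u]%SET = walk_survival t.+1 1 i.
Proof.
rewrite walk_survival1 /set_mean /degree cardsE; congr (_ * _).
by apply: eq_bigl => w; rewrite inE.
Qed.

End WalkSurvival.

Lemma random_walkE (R : realType) (T : finType) (e : rel T) (x : nat -> T)
    (n : nat) (f : T -> R) :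
  \sum_w random_walk R e x n w * f w =
    (degree e (x n))%:R^-1 * \sum_(w | e (x n) w) f w.
Proof.
rewrite big_distrr [RHS]big_mkcond; apply: eq_bigr => w _.
by rewrite /random_walk; case: ifP => //; rewrite mul0r.
Qed.

(** * Random walk: lower bound on survival *)

Section Walk.
Variables (R : realType) (T : finType) (e : rel T) (i j : T).
Variables (d : measure_display) (Omega : measurableType d).
Variables (P : probability Omega R) (X : nat -> Omega -> T).
Hypothesis law : follows P X (random_walk R e) i.

(** Induction on the remaining time [t]: [prob_step] splits on the next state just as the recursion
    of [walk_survival] does. *)
Lemma walk_survival_history t n x r : alive j x n ->
  prob P (history X x n) * walk_survival R e i j t r (x n) <=
  prob P (history X x n `&` survives X i j (visits i j x n + r) (n + t)).
Proof.
have mS := measurable_survives law j.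
have mH := measurable_history law.
elim: t n x r => [|t IH] n x [|r] al; first by rewrite !addn0 mulr1 prob_survives leqnn.
- by rewrite mulr0 prob_ge0.
- rewrite walk_survival0 mulr1 addn0.
  apply: (le_prob P) => //; first exact: measurableI.
  move=> omega h; split => //; rewrite /survives /=.
  rewrite -(@visits_ext _ i j (fun m => X m omega) x n) //.
  exact/visits_mono/leq_addr.
rewrite (prob_step law) // walk_survivalS -random_walkE big_distrr /=.
apply: ler_sum => w _; rewrite mulrA -(prob_extend law).
case: eqVneq => [|wj]; first by rewrite mulr0 prob_ge0.
have aly : alive j (extend x n w) n.+1 by rewrite alive_extend al.
have := IH n.+1 (extend x n w) _ aly.
rewrite visits_extend extend_last al wj !andbT -[(n + t.+1)%N]addSnnS => {}IH.
have [wi|wi] := eqVneq w i; last by have := IH r.+1; rewrite (negbTE wi) addn0.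
by have := IH r; rewrite wi eqxx -addnA add1n.
Qed.

Lemma walk_survival_le t r :
  walk_survival R e i j t r i <= prob P (survives X i j r t).
Proof.
have mS := measurable_survives law j r t.
rewrite (prob_start law) //.
have := @walk_survival_history t 0 (fun=> i) r isT.
by rewrite (prob_start1 law) mul1r /visits big_ord0.
Qed.

End Walk.

(** * Feedback rule: upper bound on survival *)

Section Feedback.
Variables (R : realType) (T : finType) (e : rel T) (i j : T).
Variables (d : measure_display) (Omega : measurableType d).
Variables (P : probability Omega R) (X : nat -> Omega -> T).
Hypothesis law : follows P X (local_feedback R e i) i.
Hypothesis ji : j != i.
Variable N : nat.

Let bound := survival_bound (walk_return R e i j N) [set u | e i u]%SET.

Let bound_ge0 r S : 0 <= bound r S.
Proof. by apply: survival_bound_ge0; exact: walk_return_ge0. Qed.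

Lemma feedback_step t n x r : (t <= N)%N -> x n != j -> balanced e i x n ->
  \sum_w local_feedback R e i x n w * (walk_return R e i j t w *
     bound r (Smin e (extend x n w) n.+1 i))
    <= walk_return R e i j t.+1 (x n) * bound (r + (x n == i)) (Smin e x n i).
Proof.
move=> tN xj bal; rewrite {2}/walk_return (negbTE xj).
case: eqVneq => [xi|xi]; last first.
  rewrite (eq_bigr (fun w => random_walk R e x n w *
     (walk_return R e i j t w * bound r (Smin e x n i)))) => [|w _].
    by rewrite random_walkE walk_survival1 -big_distrl /= mulrA addn0.
  by rewrite /local_feedback (negbTE xi) Smin_extend_away.
rewrite mul1r addn1; set S := Smin e x n i.
(* With no exit from [i] the rule gives every state weight 0. *)
have [/eqP|] := posnP #|S|.
  rewrite cards_eq0 => /eqP S0; rewrite big1 ?bound_ge0 // => w _.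
  by rewrite /local_feedback xi eqxx -/S S0 inE mul0r.
move=> Sgt0; apply: le_trans (@survival_bound_exit _ _ _ (@walk_return_ge0 R T e i j N)
  [set u | e i u]%SET r S (fun w => Smin e (extend x n w) n.+1 i) Sgt0 _); last first.
  by move=> w wS; rewrite Smin_extend_exit.
rewrite big_distrr /= [leRHS]big_mkcond /=; apply: ler_sum => w _.
rewrite /local_feedback xi eqxx /Kmin -/S; case: ifP => _; last by rewrite mul0r.
rewrite ler_wpM2l ?invr_ge0 // ler_wpM2r ?bound_ge0 //.
exact: walk_return_mono.
Qed.

(** Of the [r.+1] entries still required, away from [i] the first is paid by [walk_return] and the
    others by [bound]; at [i] the former is 1 and [bound] pays for all. *)
Lemma feedback_history t n x r : (t <= N)%N -> alive j x n -> x n != j ->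
    balanced e i x n ->
  prob P (history X x n `&` survives X i j (visits i j x n + r.+1) (n + t)) <=
  prob P (history X x n) * (walk_return R e i j t (x n) *
    bound (r + (x n == i)) (Smin e x n i)).
Proof.
have mS := measurable_survives law j.
have mH := measurable_history law.
elim: t n x r => [|t IH] n x r tN al xj bal.
  rewrite addn0 prob_survives ifF; last by lia.
  by rewrite mulr_ge0 ?prob_ge0 ?mulr_ge0 ?bound_ge0 ?walk_return_ge0.
apply: le_trans (ler_wpM2l (prob_ge0 P _) (feedback_step r (ltnW tN) xj bal)).
rewrite (prob_step law) // big_distrr /=; apply: ler_sum => w _.
rewrite [leRHS]mulrA -(prob_extend law); set y := extend x n w.
have y_le : prob P (history X y n.+1 `&`
    survives X i j (visits i j x n + r.+1) (n + t.+1)) <= prob P (history X y n.+1).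
  by apply: (le_prob P) => //; exact: measurableI.
(* Null histories are set aside because only a positive probability forces [w] to be a least used
   exit, which keeps the balance. *)
have [p0|pn0] := eqVneq (prob P (history X y n.+1)) 0.
  by rewrite p0 mul0r -p0.
have baly : balanced e i y n.+1.
  apply: balanced_extend => // /eqP xi; apply: contraNT pn0 => wS.
  by rewrite (prob_extend law) /local_feedback xi eqxx (negbTE wS) mulr0.
(* Meeting [j] freezes the count below its target. *)
have [wj|wj] := eqVneq w j.
  rewrite (_ : _ `&` _ = set0) ?{1}/prob ?measure0.
    by rewrite mulr_ge0 ?prob_ge0 ?mulr_ge0 ?bound_ge0 ?walk_return_ge0.
  apply/seteqP; split => // omega [h]; rewrite /survives /= -[(n + t.+1)%N]addSnnS.
  have dead : ~~ alive j (fun m => X m omega) n.+1.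
    by rewrite (alive_ext j h) alive_extend wj eqxx andbF.
  rewrite visits_dead // (visits_ext i j h) visits_extend wj eqxx !andbF addn0.
  by move=> ?; exfalso; lia.
have aly : alive j y n.+1 by rewrite /y alive_extend al.
have yj : y n.+1 != j by rewrite /y extend_last.
have := fun r => IH n.+1 y r (ltnW tN) aly yj baly.
rewrite /y visits_extend extend_last al wj !andbT -[(n + t.+1)%N]addSnnS => {}IH.
have [wi|wi] := eqVneq w i; last first.
  by have := IH r; rewrite (negbTE wi) !addn0.
(* For [r = 0] this entry to [i] was the last one required: both factors are 1 and the trivial bound
   [y_le] suffices. *)
case: r y_le IH => [|r] y_le IH.
  rewrite -[(n + t.+1)%N]addSnnS /y in y_le.
  by rewrite /walk_return (negbTE wj) (introT eqP wi) /bound survival_bound_0 !mulr1.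
by have := IH r; rewrite wi eqxx -addnA add1n addn1.
Qed.

Lemma feedback_survival_le r :
  prob P (survives X i j r N) <= walk_survival R e i j N.+1 1 i ^+ r.
Proof.
have mS := measurable_survives law j r N.
case: r mS => [|r] mS.
  by rewrite expr0 -lee_fin EFin_prob // probability_le1.
rewrite (prob_start law) //.
have := @feedback_history N 0 (fun=> i) r (leqnn _) isT.
rewrite eq_sym => /(_ ji (@balanced0 _ _ _ _)).
rewrite (prob_start1 law) mul1r /visits big_ord0 add0n => /le_trans; apply.
rewrite /walk_return eq_sym (negbTE ji) eqxx mul1r addn1 Smin0 -set_mean_exits.
by apply: survival_bound_full; exact: walk_return_ge0.
Qed.

End Feedback.

(** * The hitting excursion as a sum of survival indicators *)

Section Times.
Variables (R : realType) (T : finType) (i j : T) (x : nat -> T).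
Hypothesis ji : j != i.
Implicit Types (A : set nat) (n k m : nat).

Local Notation ext n := (n%:R%:E : \bar R).
Local Notation natinf A := (ereal_inf [set ext n | n in A]).

Lemma natinf_lt A z : (natinf A < z)%E <-> exists2 n, A n & (ext n < z)%E.
Proof.
split=> [/ereal_inf_ltP[_ [n An <-]]|[n An nz]]; first by exists n.
by apply/ereal_inf_ltP; exists (ext n) => //; exists n.
Qed.

Lemma natinf_nat A : natinf A = +oo%E \/ exists n, natinf A = ext n.
Proof.
have [exA|A0] := pselect (exists n, `[< A n >]); last first.
  left; rewrite (_ : A = set0) ?image_set0 ?ereal_inf0 //.
  by apply/seteqP; split => // n An; case: A0; exists n; exact/asboolP.
right; case: (@ex_minnP (fun n => `[< A n >]) exA) => m /asboolP Am mmin; exists m.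
apply/eqP; rewrite eq_le ereal_inf_lbound /=; last by exists m.
apply: le_ereal_inf_tmp => _ [k Ak <-]; rewrite lee_fin ler_nat.
exact/mmin/asboolP.
Qed.

Lemma natinf_ge0 A : (0 <= natinf A)%E.
Proof. by apply: le_ereal_inf_tmp => _ [k Ak <-]; rewrite lee_fin. Qed.

Definition returns n : nat := \sum_(m < n) (x m.+1 == i).

Lemma returnsS n : returns n.+1 = (returns n + (x n.+1 == i))%N.
Proof. by rewrite /returns big_ord_recr. Qed.

Lemma returnsSP k n : (k < returns n)%N <->
  exists2 m, (m < n)%N & (k <= returns m)%N /\ x m.+1 = i.
Proof.
elim: n => [|n IH]; first by rewrite /returns big_ord0; split=> // -[].
rewrite returnsS; split=> [h|[m]].
  have [/IH[m mn hm]|kn] := boolP (k < returns n)%N.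
    by exists m => //; exact: leqW.
  by exists n => //; case: eqP h => [|_] h; split=> //; lia.
rewrite ltnS leq_eqVlt => /predU1P[->|mn] [km xm]; first by rewrite xm eqxx addn1.
by apply: leq_trans (leq_addr _ _); apply/IH; exists m.
Qed.

(** Duality of return times and counts; it is strict against [n.+1] because an infimum yields a
    witness only below a strict bound. *)
Lemma return_time_ltP k n :
  (return_time R x i k < ext n.+1)%E <-> (k <= returns n)%N.
Proof.
elim: k n => [|k IH] n /=; first by rewrite lte_fin ltr0n.
rewrite natinf_lt returnsSP; split=> [[[|m] [Vm xm]]|[m mn [km xm]]].
- suff : (0 <= return_time R x i k)%E by rewrite leNgt Vm.
  by case: k {IH Vm} => //= k; exact: natinf_ge0.
- by rewrite lte_fin ltr_nat ltnS => mn; exists m => //; split=> //; exact/IH.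
- by exists m.+1; [split=> //; exact/IH|rewrite lte_fin ltr_nat].
Qed.

Lemma return_time_nat k :
  return_time R x i k = +oo%E \/ exists n, return_time R x i k = ext n.
Proof. by case: k => [|k]; [right; exists 0%N|exact: natinf_nat]. Qed.

Lemma hitting_time_ltP n : (hitting_time R x j < ext n.+1)%E <-> ~~ alive j x n.
Proof.
rewrite natinf_lt; split=> [[[|m] [] // _ xm]|].
  rewrite lte_fin ltr_nat ltnS => mn; apply/negP => /(alive_antimono mn) /=.
  by rewrite xm eqxx andbF.
elim: n => [|n IH] //=; rewrite negb_and negbK => /orP[/IH[m hm mn]|/eqP xn].
  by exists m => //; apply: lt_trans mn _; rewrite lte_fin ltr_nat.
by exists n.+1 => //; rewrite lte_fin ltr_nat.
Qed.

Lemma visits_alive n : alive j x n -> visits i j x n = returns n.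
Proof.
elim: n => [|n IH]; first by rewrite /visits /returns !big_ord0.
move=> al; rewrite visitsS returnsS al andbT IH //.
by case/andP: al.
Qed.

(** Once [j] is met the count is frozen, so one can go back to a time still alive, where it equals
    [returns]. *)
Lemma visitsP k : (exists n, (k <= visits i j x n)%N) <->
  exists n, (k <= returns n)%N /\ alive j x n.
Proof.
split=> [[n]|[n [kn al]]]; last by exists n; rewrite visits_alive.
elim: n => [|n IH].
  by move=> h; exists 0%N; split; rewrite // -visits_alive.
have [al|dead] := boolP (alive j x n.+1).
  by move=> h; exists n.+1; rewrite -visits_alive.
by rewrite visitsS (negbTE dead) andbF addn0.
Qed.

(** [V_k < T_j] is the event [N_j > k]. The strict inequality makes [V_k] a natural time, at which
    [j] is not yet met and [k] returns are made. *)
Lemma return_lt_hittingP k : (return_time R x i k < hitting_time R x j)%E <->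
  exists n, (k <= visits i j x n)%N.
Proof.
rewrite visitsP; split=> [Vj|[n [/return_time_ltP Vn /negP al]]]; last first.
  apply: lt_le_trans Vn _; rewrite leNgt; apply/negP => /hitting_time_ltP.
  by move=> dead; apply: al; rewrite -[alive _ _ _]negbK dead.
have [Voo|[n Vn]] := return_time_nat k.
  by move: Vj; rewrite Voo ltNge leey.
exists n; split; first by apply/return_time_ltP; rewrite Vn lte_fin ltr_nat.
rewrite -[alive _ _ _]negbK; apply/negP => /hitting_time_ltP.
have : (ext n < hitting_time R x j)%E by rewrite -Vn.
case: (natinf_nat [set n | (1 <= n)%N /\ x n = j]) => [|[m]]; rewrite /hitting_time => ->.
  by move=> _; rewrite ltNge leey.
by rewrite !lte_fin !ltr_nat; lia.
Qed.

(** Both sides are the length of the initial segment [Q], possibly infinite. *)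
Lemma natinf_failure (Q : set nat) : Q 0%N ->
    (forall k m, (k <= m)%N -> Q m -> Q k) ->
  natinf [set k | (1 <= k)%N /\ ~ Q k] = (\sum_(0 <= k <oo) (\1_Q k : R)%:E)%E.
Proof.
move=> Q0 Qmono; have [Qall|] := pselect (forall k, Q k).
  rewrite (_ : [set k | _] = set0); last by apply/seteqP; split=> // k [_]; exact.
  rewrite image_set0 ereal_inf0; apply/esym/eqyP => A _.
  have [n An] : exists n : nat, A <= n%:R.
    exists (Num.bound `|A|); rewrite (le_trans (ler_norm _)) // ltW //.
    exact: archi_boundP.
  (* The partial sum of [n] ones already exceeds [A]. *)
  apply: (@le_trans _ _ (ext n)); first by rewrite lee_fin.
  apply: le_trans (nneseries_lim_ge n _) => [|k _ _]; last by rewrite lee_fin.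
  rewrite (eq_bigr (fun=> 1%E)) => [|k _]; last by rewrite indicE mem_set.
  by rewrite sumEFin big_const_nat subn0 iter_addr_0.
move/existsNP => [k1 Qk1].
case: (@ex_minnP (fun k => `[< ~ Q k >])); first by exists k1; exact/asboolP.
move=> k0 /asboolP Qk0 k0min.
have QE k : (k \in Q) = (k < k0)%N.
  apply/idP/idP => [/set_mem Qk|kk0].
    by rewrite ltnNge; apply/negP => /Qmono /(_ Qk).
  apply/mem_set; apply: contrapT => nQk.
  by have := k0min k (asboolT nQk); rewrite leqNgt kk0.
(* [Q 0] puts the first failure in the range [1 <= k]. *)
have k0_gt0 : (0 < k0)%N by rewrite -QE mem_set.
rewrite (nneseries_split 0%N k0) => [|k _]; last by rewrite lee_fin.
rewrite add0n eseries0 ?adde0 => [|k k0k _]; last first.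
  by rewrite indicE QE ltnNge k0k.
rewrite (eq_big_nat _ _ (F2 := fun=> 1%E)) => [|k /andP[_ kk0]]; last first.
  by rewrite indicE QE kk0.
rewrite sumEFin big_const_nat subn0 iter_addr_0.
apply/eqP; rewrite eq_le ereal_inf_lbound /=; last by exists k0.
apply: le_ereal_inf_tmp => _ [k [_ Qk] <-]; rewrite lee_fin ler_nat.
exact/k0min/asboolP.
Qed.

Lemma hitting_excursionE : hitting_excursion R x i j =
  (\sum_(0 <= k <oo) (\1_[set k | exists n, (k <= visits i j x n)%N] k : R)%:E)%E.
Proof.
rewrite -natinf_failure.
- congr (natinf _); apply/seteqP; split=> k /= [k1 h]; split=> //.
    by move/return_lt_hittingP; rewrite ltNge h.
  by rewrite leNgt; apply/negP => /return_lt_hittingP.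
- by exists 0%N.
- by move=> k m km [n mn]; exists n; exact: leq_trans mn.
Qed.

End Times.

(** * The mean of [N_j] as a series of survival probabilities *)

Section MeanExcursion.
Variables (R : realType) (T : finType) (p : rule R T) (i j : T).
Variables (d : measure_display) (Omega : measurableType d).
Variables (P : probability Omega R) (X : nat -> Omega -> T).
Hypothesis law : follows P X p i.
Hypothesis ji : j != i.

Local Notation surv r := (\bigcup_n survives X i j r n).

Lemma measurable_bigcup_survives r : measurable (surv r).
Proof. by apply: bigcup_measurable => n _; exact: measurable_survives law _ _ _. Qed.

(** Tail-sum formula; nonnegative terms let sum and integral be exchanged. *)
Lemma mean_hitting_excursionE :
  mean_hitting_excursion P X i j = (\sum_(0 <= r <oo) P (surv r))%E.
Proof.
have mS := measurable_bigcup_survives.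
rewrite /mean_hitting_excursion.
rewrite (eq_integral (fun omega => \sum_(0 <= r <oo) (\1_(surv r) omega : R)%:E)%E);
  last first.
  move=> omega _; rewrite (hitting_excursionE R _ ji); apply: eq_eseriesr => r _.
  rewrite !indicE; congr (_ %:R%:E); congr nat_of_bool; apply/idP/idP.
    by move=> /set_mem[n rn]; apply/mem_set; exists n.
  by move=> /set_mem[n _ rn]; apply/mem_set; exists n.
rewrite integral_nneseries //; last first.
  by move=> r; apply/measurable_EFinP; exact: measurable_indic.
by apply: eq_eseriesr => r _; rewrite integral_indic // setIT.
Qed.

Lemma nondecreasing_survives r :
  {homo survives X i j r : m n / (m <= n)%N >-> (m <= n)%O}.
Proof.
move=> m n mn; apply/subsetPset => omega /leq_trans; apply.
exact: visits_mono.
Qed.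

(** Continuity from below: the events grow with the horizon [n]. *)
Lemma bigcup_survives_le r (c : \bar R) :
  (forall n, P (survives X i j r n) <= c)%E -> (P (surv r) <= c)%E.
Proof.
move=> Pc; have mS := measurable_survives law j r.
have cvgS := nondecreasing_cvg_mu (mu := P) mS (measurable_bigcup_survives r)
  (@nondecreasing_survives r).
rewrite -(cvg_lim _ cvgS) //; apply: lime_le; first by apply/cvg_ex; eexists; exact: cvgS.
exact: nearW.
Qed.

Lemma survives_le_bigcup r n : (P (survives X i j r n) <= P (surv r))%E.
Proof.
apply: le_measure; rewrite ?inE.
- exact: measurable_survives law _ _ _.
- exact: measurable_bigcup_survives.
- exact: bigcup_sup.
Qed.

End MeanExcursion.

Theorem theorem1 (R : realType) (T : finType) (e : rel T)
    (e_connected : connected_graph e) (i : T)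
    (d_loc : measure_display) (Omega_loc : measurableType d_loc)
    (P_loc : probability Omega_loc R) (X_loc : nat -> Omega_loc -> T)
    (d_rw : measure_display) (Omega_rw : measurableType d_rw)
    (P_rw : probability Omega_rw R) (X_rw : nat -> Omega_rw -> T)
    (X_loc_law : follows P_loc X_loc (local_feedback R e i) i)
    (X_rw_law : follows P_rw X_rw (random_walk R e) i) :
  forall j : T, j <> i ->
    (mean_hitting_excursion P_loc X_loc i j
       <= mean_hitting_excursion P_rw X_rw i j)%E.
Proof.
move=> j /eqP ji.
rewrite (mean_hitting_excursionE X_loc_law ji) (mean_hitting_excursionE X_rw_law ji).
apply: lee_nneseries => [r _ _|r _]; first exact: measure_ge0.
apply: (bigcup_survives_le X_loc_law) => n.
(* Each of the [r] excursions gets one step to leave [i] and [n] to return, matching [abar_n]. *)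
apply: le_trans (survives_le_bigcup j X_rw_law r (r * n.+1)).
rewrite -!EFin_prob ?lee_fin; [|exact: measurable_survives X_rw_law _ _ _
  |exact: measurable_survives X_loc_law _ _ _].
apply: le_trans (walk_survival_le j X_rw_law _ _).
apply: le_trans (@walk_survival_expr R T e i j n.+1 r).
exact: feedback_survival_le X_loc_law ji _ _.
Qed.
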